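(* Let $D$ be a finite domain, $r$ a database instance over $D$, and $IC$ a set of binary integrity constraints. Let $\Pi^D(r)$ be the change program $\Pi_\Delta(r)$ together with the weak constraints $\Leftarrow p'(\bar X),\ not\ p(\bar X)$ and $\Leftarrow \neg p'(\bar X),\ p(\bar X)$ for every database predicate $p$. Then: 1. For every Dalal repair $r'$ of $r$ with respect to $IC$, there exists an answer set $S$ of $\Pi^D(r)$ such that $I(S)=r'$. 2. For every answer set $S$ of $\Pi^D(r)$, there exists a Dalal repair $r'$ of $r$ with respect to $IC$ such that $I(S)=r'$.
   Context: **Databases.** $D$ is a finite set of constants. A schema is a finite set of database predicates $p$ (with arities). There may also be built-in predicates (equality, order, etc.), which have a fixed interpretation over $D$. A database instance is a finite set of ground atoms $p(\bar a)$, $p$ a database predicate, $\bar a$ a tuple over $D$ (built-in atoms are not members of instances). Instances are viewed as first-order structures with domain $D$: $r\models p(\bar a)$ iff $p(\bar a)\in r$. **Binary integrity constraints (BICs).** A BIC is a universally quantified formula $\bigvee_{i=1}^n p_i(\bar x_i)\vee\bigvee_{i=1}^m\neg q_i(\bar y_i)\vee\varphi$ with $1\le n+m\le 2$, where $p_i,q_i$ are database predicates, $\bar x_i,\bar y_i$ are tuples of variables, and $\varphi$ is a formula containing only built-in predicates, whose variables are among those of the $\bar x_i,\bar y_i$. A set $IC$ of BICs is always assumed consistent: some database instance over $D$ satisfies it. **Dalal repairs.** $\Delta(r,r')$ denotes the symmetric difference. An instance $r'$ over the same schema and domain is a Dalal repair of $r$ w.r.t. $IC$ iff $r'\models IC$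 and $|\Delta(r,r')|$ is the minimum of $\{|\Delta(r,r^* )| \mid r^*\models IC\}$. **Programs.** Literals are atoms $A$ or their classical negations $\neg A$; $not$ is weak negation. For each database predicate $p$ there is a new predicate $p'$ of the same arity, and there is a unary predicate $dom$. $dom(\bar X_1,\dots,\bar X_k)$ abbreviates the conjunction of $dom(X)$ over all components $X$ of the tuples. All rules and weak constraints are identified with their ground instances over $D$. A condition $not\ \varphi$ with $\varphi$ built-in is evaluated in the fixed interpretation (it holds iff $\varphi$ is false). The change program $\Pi_\Delta(r)$ consists of: 1. Facts: $p(\bar a)$ for every $p(\bar a)\in r$; $dom(a)$ for every $a\in D$. 2. For each BIC $\bigvee_{i=1}^n p_i(\bar x_i)\vee\bigvee_{i=1}^m\neg q_i(\bar y_i)\vee\varphi$ in $IC$, the triggering rule $\bigvee_{i=1}^n p_i'(\bar X_i)\vee\bigvee_{i=1}^m\neg q_i'(\bar Y_i)\leftarrow dom(\bar X_1,\dots,\bar X_n),\ not\ p_1(\bar X_1),\dots,not\ p_n(\bar X_n),\ q_1(\bar Y_1),\dots,q_m(\bar Y_m),\ not\ \varphi.$ 3. Stabilizing rules. For each BIC with $n+m=2$, and each of its two database literals: the rule whose head is the primed version of the other literal and whose body is $dom(\bar X_1,\dots,\bar X_n,\bar Y_1,\dots,\bar Y_m)$, the complement of the primed version of the chosen literal, and $not\ \varphi$ (so choosing $p_j(\bar x_j)$ puts $\neg p_j'(\bar X_j)$ in the body, and choosing $\neg q_j(\bar y_j)$ puts $q_j'(\bar Y_j)$ in the body). For each BIC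 with $n+m=1$: the rule $p_1'(\bar X_1)\leftarrow dom(\bar X_1),\ not\ \varphi$ if $n=1$, respectively $\neg q_1'(\bar Y_1)\leftarrow dom(\bar Y_1),\ not\ \varphi$ if $m=1$. **Answer sets.** For a ground program $\Pi$ (without weak constraints) and a set $S$ of ground literals without complementary pairs, the reduct ${}^S\Pi$ is obtained by deleting every rule having some $not\ L$ in its body with $L\in S$, and deleting all conditions $not\ L$ from the remaining rules. $S$ is an answer set of $\Pi$ if $S$ is a minimal (under inclusion) set of ground literals without complementary pairs that satisfies all rules of ${}^S\Pi$ (if all body literals are in the set, then some head literal is in the set). **Weak constraints.** A ground weak constraint $\Leftarrow L_1,\dots,L_k$ is violated by $S$ if all its conditions hold in $S$ (a literal $L$ holds iff $L\in S$; $not\ L$ holds iff $L\notin S$). The answer sets of a program with weak constraints are those answer sets of the program without the weak constraints that violate the minimum number of ground weak constraints among all its answer sets. **The instance $I(S)$.** For a set $S$ of ground literals, $I(S)=\{p(\bar a)\mid p'(\bar a)\in S\}\cup\{p(\bar a)\mid p(\bar a)\in S\text{ and }\neg p'(\bar a)\notin S\}$, where $p$ ranges over database predicates. *)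

(* Defs.v *)
From HB Require Import structures.
From mathcomp Require Import all_boot.

Set Implicit Arguments.
Unset Strict Implicit.
Unset Printing Implicit Defensive.

(* Built-in formulas over the constants [D] and the built-in predicates [B] of
   arity [bar].  [bform D bar k] is the type of first-order formulas whose free
   variables are among [0, ..., k-1]; a quantifier binds variable [0] of its
   body and shifts the others. *)
Inductive bterm (D : Type) (k : nat) :=
  | BVar of 'I_k
  | BCst of D.

Inductive bform (D B : Type) (bar : B -> nat) : nat -> Type :=
  | BFalse k : bform D bar k
  | BPred k (b : B) of (bar b).-tuple (bterm D k) : bform D bar k
  | BNot k of bform D bar k : bform D bar k
  | BAnd k of bform D bar k & bform D bar k : bform D bar k
  | BOr k of bform D bar k & bform D bar k : bform D bar k
  | BAll k of bform D bar k.+1 : bform D bar k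
  | BEx k of bform D bar k.+1 : bform D bar k.

Definition bterm_eval (D : Type) k (v : 'I_k -> D) (t : bterm D k) : D :=
  match t with BVar i => v i | BCst d => d end.

Definition extend (D : Type) k (d : D) (v : 'I_k -> D) (i : 'I_k.+1) : D :=
  if unlift ord0 i is Some j then v j else d.

Fixpoint bform_eval (D : finType) (B : Type) (bar : B -> nat)
    (bI : forall b, pred ((bar b).-tuple D)) k (f : bform D bar k) :
    ('I_k -> D) -> bool :=
  match f in bform _ _ k return ('I_k -> D) -> bool with
  | BFalse _ => fun=> false
  | BPred _ b ts => fun v => bI b (map_tuple (bterm_eval v) ts)
  | BNot _ g => fun v => ~~ bform_eval bI g v
  | BAnd _ g h => fun v => bform_eval bI g v && bform_eval bI h v
  | BOr _ g h => fun v => bform_eval bI g v || bform_eval bI h v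
  | BAll _ g => fun v => [forall d, bform_eval bI g (extend d v)]
  | BEx _ g => fun v => [exists d, bform_eval bI g (extend d v)]
  end.

Section Databases.

Context (D P : finType) (ar : P -> nat).

(* [Tagged _ t : gatom] is the ground atom [p(t)]. *)
Definition gatom : finType := {p : P & (ar p).-tuple D}.

Definition instance := {set gatom}.

Definition sym_diff (r r' : instance) : instance := (r :\: r') :|: (r' :\: r).

(* Database atoms over the variables [0, ..., k-1]. *)
Definition vatom (k : nat) := {p : P & (ar p).-tuple 'I_k}.

Definition ground k (v : 'I_k -> D) (a : vatom k) : gatom :=
  Tagged (fun p => (ar p).-tuple D) (map_tuple v (tagged a)).

Context (B : Type) (bar : B -> nat) (bI : forall b, pred ((bar b).-tuple D)).

(* The universal closure of
     \/_{a in bic_pos} a  \/  \/_{a in bic_neg} ~ a  \/  bic_phi,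
   whose variables are exactly [0, ..., bic_k-1]: by [bic_vars] each of them
   occurs in a database atom, so the free variables of [bic_phi] do too. *)
Record bic := Bic {
  bic_k : nat;
  bic_pos : seq (vatom bic_k);
  bic_neg : seq (vatom bic_k);
  bic_phi : bform D bar bic_k;
  bic_size : 1 <= size bic_pos + size bic_neg <= 2;
  bic_vars : forall i : 'I_bic_k,
    has (fun a => i \in tval (tagged a)) (bic_pos ++ bic_neg)
}.

Definition sat_bic (r : instance) (c : bic) : Prop :=
  forall v : 'I_(bic_k c) -> D,
    [|| has (fun a => ground v a \in r) (bic_pos c),
        has (fun a => ground v a \notin r) (bic_neg c)
      | bform_eval bI (bic_phi c) v].

Definition sat_ics (IC : bic -> Prop) (r : instance) : Prop :=
  forall c, IC c -> sat_bic r c.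

Definition consistent_ics (IC : bic -> Prop) : Prop := exists r, sat_ics IC r.

Definition dalal_repair (IC : bic -> Prop) (r r' : instance) : Prop :=
  sat_ics IC r' /\
  forall rs, sat_ics IC rs -> #|sym_diff r r'| <= #|sym_diff r rs|.

(* Ground atoms of the programs: [p(t)], the primed [p'(t)], and [dom(d)]. *)
Inductive patom :=
  | AOld of gatom
  | ANew of gatom
  | ADom of D.

Definition patom_code (a : patom) : gatom + gatom + D :=
  match a with
  | AOld g => inl (inl g)
  | ANew g => inl (inr g)
  | ADom d => inr d
  end.

Definition patom_decode (x : gatom + gatom + D) : patom :=
  match x with
  | inl (inl g) => AOld g
  | inl (inr g) => ANew g
  | inr d => ADom d
  end.

Lemma patom_codeK : cancel patom_code patom_decode.
Proof. by case. Qed.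

HB.instance Definition _ := Finite.copy patom (can_type patom_codeK).

(* [(true, a)] is the literal [a] and [(false, a)] its classical negation. *)
Definition lit : finType := (bool * patom)%type.

Definition compl (l : lit) : lit := (~~ l.1, l.2).

Definition no_compl (S : {set lit}) : Prop :=
  forall l : lit, l \in S -> compl l \notin S.

(* Ground disjunctive rules
     head <- pos, not naf, cond
   where [cond] is the truth value of the built-in conditions in the body. *)
Record rule := Rule {
  rhead : seq lit;
  rpos : seq lit;
  rnaf : seq lit;
  rcond : bool
}.

Definition rules := rule -> Prop.

Definition reduct (S : {set lit}) (Pi : rules) : rules := fun q =>
  exists rl, [/\ Pi rl, ~~ has (mem S) (rnaf rl)
    & q = Rule (rhead rl) (rpos rl) [::] (rcond rl)].

Definition holds_rule (S : {set lit}) (rl : rule) : Prop :=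
  all (mem S) (rpos rl) -> ~~ has (mem S) (rnaf rl) -> rcond rl ->
  has (mem S) (rhead rl).

Definition holds_rules (S : {set lit}) (Pi : rules) : Prop :=
  forall rl, Pi rl -> holds_rule S rl.

Definition answer_set (Pi : rules) (S : {set lit}) : Prop :=
  [/\ no_compl S, holds_rules S (reduct S Pi)
    & forall T : {set lit}, no_compl T -> holds_rules T (reduct S Pi) ->
        T \subset S -> T = S].

(* [(pos, naf)] is the ground weak constraint [<= pos, not naf]. *)
Definition wconstraint : finType := ({set lit} * {set lit})%type.

Definition violated (S : {set lit}) (w : wconstraint) : bool :=
  (w.1 \subset S) && [disjoint w.2 & S].

Definition nviolated (W : {set wconstraint}) (S : {set lit}) : nat :=
  #|[set w in W | violated S w]|.

Record wprogram := WProgram {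
  wp_rules : rules;
  wp_weak : {set wconstraint}
}.

Definition wanswer_set (Pi : wprogram) (S : {set lit}) : Prop :=
  answer_set (wp_rules Pi) S /\
  forall T, answer_set (wp_rules Pi) T ->
    nviolated (wp_weak Pi) S <= nviolated (wp_weak Pi) T.

Definition old (a : gatom) : lit := (true, AOld a).
Definition new (a : gatom) : lit := (true, ANew a).
Definition nnew (a : gatom) : lit := (false, ANew a).
Definition dom (d : D) : lit := (true, ADom d).

Definition doms k (v : 'I_k -> D) (s : seq (vatom k)) : seq lit :=
  [seq dom (v i) | i <- flatten [seq tval (tagged a) | a <- s]].

(* The database literals of a constraint, with their signs. *)
Definition bic_lits (c : bic) : seq (bool * vatom (bic_k c)) :=
  [seq (true, a) | a <- bic_pos c] ++ [seq (false, a) | a <- bic_neg c].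

Definition primed k (v : 'I_k -> D) (l : bool * vatom k) : lit :=
  (l.1, ANew (ground v l.2)).

Definition trigger (c : bic) (v : 'I_(bic_k c) -> D) : rule :=
  Rule [seq primed v l | l <- bic_lits c]
       (doms v (bic_pos c) ++ [seq old (ground v a) | a <- bic_neg c])
       [seq old (ground v a) | a <- bic_pos c]
       (~~ bform_eval bI (bic_phi c) v).

Definition stabilize (c : bic) (v : 'I_(bic_k c) -> D)
    (head : lit) (body : seq lit) : rule :=
  Rule [:: head] (doms v (bic_pos c ++ bic_neg c) ++ body) [::]
       (~~ bform_eval bI (bic_phi c) v).

Inductive change_program (IC : bic -> Prop) (r : instance) : rules :=
  | fact_old a of a \in r :
      change_program IC r (Rule [:: old a] [::] [::] true)
  | fact_dom d :
      change_program IC r (Rule [:: dom d] [::] [::] true)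
  | rule_trigger c v of IC c :
      change_program IC r (@trigger c v)
  | rule_stabilize2 c v chosen other of IC c
      & (bic_lits c = [:: chosen; other] \/ bic_lits c = [:: other; chosen]) :
      change_program IC r
        (@stabilize c v (primed v other) [:: compl (primed v chosen)])
  | rule_stabilize1 c v l of IC c & bic_lits c = [:: l] :
      change_program IC r (@stabilize c v (primed v l) [::]).

Definition change_weak : {set wconstraint} :=
  [set ([set new a], [set old a]) | a : gatom] :|:
  [set ([set nnew a; old a], set0) | a : gatom].

Definition dalal_program (IC : bic -> Prop) (r : instance) : wprogram :=
  WProgram (change_program IC r) change_weak.

Definition inst_of (S : {set lit}) : instance :=
  [set a | new a \in S] :|: [set a | (old a \in S) && (nnew a \notin S)].

End Databases.

(* Main.v *)
(* An answer set consists of [r], the [dom] facts and a consistent set [M] of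
   primed literals; [inst_of] overrides [r] by [M].  The triggering rules repair
   the clauses violated by [r], and the stabilizing rules, which are the
   implications of the 2-clauses, prevent [M] from breaking the other ones, so
   the resulting instance satisfies [IC].  Conversely, if [r'] satisfies [IC],
   then the primed literals true in [r'] satisfy all rules of the reduct; a
   minimal subset of them that still does is an answer set, and the changes it
   makes are among those leading from [r] to [r'].  As the number of violated
   weak constraints is the number of changes, optimal answer sets correspond
   to Dalal repairs. *)
Require Import Defs.
From mathcomp Require Import all_boot.
From mathcomp Require Import boolp.

Set Implicit Arguments.
Unset Strict Implicit.
Unset Printing Implicit Defensive.

Lemma holds_reductP (D P : finType) (ar : P -> nat) (S T : {set lit D ar})
    (Pi : rules D ar) :
  holds_rules T (reduct S Pi) <->
  forall rl, Pi rl -> ~~ has (mem S) (rnaf rl) -> all (mem T) (rpos rl) ->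
    rcond rl -> has (mem T) (rhead rl).
Proof.
split=> [H rl Prl nS aT cond|H _ [rl [Prl nS ->]] /= aT _ cond].
  by apply: (H (Rule (rhead rl) (rpos rl) [::] (rcond rl))) => //; exists rl.
exact: (H rl).
Qed.

Section ChangeProgram.

Context (D P : finType) (ar : P -> nat).
Context (B : Type) (bar : B -> nat) (bI : forall b, pred ((bar b).-tuple D)).
Context (IC : bic D ar bar -> Prop) (r : instance D ar).

Local Notation Pi := (change_program bI IC r).

Definition lit_true (r' : instance D ar) k (v : 'I_k -> D)
    (l : bool * vatom ar k) : bool := (ground v l.2 \in r') == l.1.

Lemma sat_bicE (r' : instance D ar) (c : bic D ar bar) :
  sat_bic bI r' c <-> forall v : 'I_(bic_k c) -> D,
    has (lit_true r' v) (bic_lits c) || bform_eval bI (bic_phi c) v.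
Proof.
have E v : has (lit_true r' v) (bic_lits c) =
    has (fun a => ground v a \in r') (bic_pos c) ||
    has (fun a => ground v a \notin r') (bic_neg c).
  rewrite has_cat !has_map; congr (_ || _); apply: eq_has => a /=.
    by rewrite /lit_true /= eqb_id.
  by rewrite /lit_true /= eqbF_neg.
by split=> H v; move: (H v); rewrite E orbA.
Qed.

(** Weak negation occurs only in triggering rules, and only before [old] atoms, so the reduct by a
    set depends on its [old] atoms alone. *)
Lemma eq_has_naf (rl : rule D ar) (S T : {set lit D ar}) :
  (forall a, (old a \in S) = (old a \in T)) -> Pi rl ->
  has (mem S) (rnaf rl) = has (mem T) (rnaf rl).
Proof.
move=> eqST; case=> [a _|d|c v _|c v ch ot _ _|c v l _ _] //=.
by rewrite !has_map; apply: eq_has => a /=; rewrite eqST.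
Qed.

Lemma all_doms (S : {set lit D ar}) k (v : 'I_k -> D) s :
  (forall d, dom ar d \in S) -> all (mem S) (doms v s).
Proof. by move=> domS; apply/allP => _ /mapP[i _ ->]; apply: domS. Qed.

Section Models.

Context (S T : {set lit D ar}).
Hypothesis modT : holds_rules T (reduct S Pi).

Lemma model_old a : a \in r -> old a \in T.
Proof.
move=> ar'; have /holds_reductP/(_ _ (fact_old bI IC ar')) := modT.
by rewrite /= orbF; apply.
Qed.

Lemma model_dom d : dom ar d \in T.
Proof.
have /holds_reductP/(_ _ (fact_dom bI IC r d)) := modT.
by rewrite /= orbF; apply.
Qed.

End Models.

Section AnswerSets.

Context (S : {set lit D ar}).
Hypothesis ansS : answer_set Pi S.

(** Minimality: the facts from [r] are the only rules with an [old] atom in the head, so removing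
    any other [old a] from [S] would leave a smaller model of the reduct. *)
Lemma answer_old a : (old a \in S) = (a \in r).
Proof.
case: ansS => ncS modS minS; apply/idP/idP => [aS|]; last exact: model_old modS a.
apply: contraLR aS => anr; rewrite -(minS (S :\ old a)) ?subsetDl ?setD11 //.
  move=> l; rewrite !inE => /andP[_ lS].
  by rewrite (negbTE (ncS _ lS)) andbF.
apply/holds_reductP => rl Prl nS aT cond.
have aS : all (mem S) (rpos rl).
  by apply: sub_all aT => l /=; rewrite !inE => /andP[].
have /holds_reductP/(_ _ Prl nS aS cond) := modS.
rewrite (@eq_in_has _ _ (mem (S :\ old a))) // => l lh.
suff : l != old a by rewrite /= !inE => ->.
case: Prl lh {nS aT aS cond} => [b br|d|c v _|c v ch ot _ Ec|c v m _ Ec] /=.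
- by rewrite inE => /eqP ->; apply: contraNneq anr => -[<-].
- by rewrite inE => /eqP ->.
- by case/mapP=> -[[] b] _ ->.
- by rewrite inE => /eqP ->; case: ot {Ec} => -[].
- by rewrite inE => /eqP ->; case: m {Ec} => -[].
Qed.

Lemma inst_ofE a :
  (a \in inst_of S) = (new a \in S) || ((a \in r) && (nnew a \notin S)).
Proof. by rewrite !inE answer_old. Qed.

Lemma primed_true k (v : 'I_k -> D) l :
  primed v l \in S -> lit_true (inst_of S) v l.
Proof.
case: ansS => ncS _ _; case: l => -[] a lS; rewrite /lit_true inst_ofE /=.
  by rewrite [new _ \in S]lS.
rewrite [nnew _ \in S]lS andbF orbF; apply/eqP/negbTE.
exact: (ncS (primed v (false, a))).
Qed.

(** By default [inst_of S] keeps the truth value from [r], so only a primed literal of [S] can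
    change it. This supplies the body of a stabilizing rule. *)
Lemma primed_changed k (v : 'I_k -> D) l :
  lit_true r v l -> ~~ lit_true (inst_of S) v l ->
  compl (primed v l) \in S.
Proof.
case: l => -[] a; rewrite /lit_true inst_ofE /= => /eqP ->.
  by rewrite eqb_id negb_or negbK => /andP[].
by rewrite eqbF_neg negbK orbF.
Qed.

Lemma inst_of_sat : sat_ics bI IC (inst_of S).
Proof.
case: ansS => _ modS _ c ICc; apply/sat_bicE => v.
case phi: (bform_eval _ _ v); rewrite ?orbT // orbF.
apply: contraT => nI.
have domS := model_dom modS.
have Hrule := (iffLR (holds_reductP S S Pi)) modS.
have nS : ~~ has (fun l => primed v l \in S) (bic_lits c).
  by apply: contra nI; apply: sub_has => l; apply: primed_true.
have nIl l : l \in bic_lits c -> ~~ lit_true (inst_of S) v l.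
  by move=> lc; apply: contra nI => ?; apply/hasP; exists l.
have [/hasP[l lc lr]|nr] := boolP (has (lit_true r v) (bic_lits c)).
  have cS := primed_changed lr (nIl _ lc).
  (* Once [ch] has been falsified, its stabilizing rule derives [ot], against [nS]. *)
  have fire (ch ot : bool * vatom ar (bic_k c)) :
      bic_lits c = [:: ch; ot] \/ bic_lits c = [:: ot; ch] ->
      compl (primed v ch) \in S -> false.
    move=> Ec chS; have := Hrule _ (rule_stabilize2 bI r v ICc Ec).
    rewrite /= all_cat all_doms //= chS phi orbF => /(_ isT isT isT) otS.
    case/negP: nS; apply/hasP; exists ot => //.
    by case: Ec => ->; rewrite !inE eqxx ?orbT.
  have sz := bic_size c.
  (* A single literal is derived unconditionally; of two, the one lost forces the other; three or
     more contradict [bic_size]. *)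
  case Ec : (bic_lits c) (fire) lc => [|l1 [|l2 [|l3 s]]] //= {}fire.
  - move=> _; have := Hrule _ (rule_stabilize1 bI r v ICc Ec).
    rewrite /= cats0 all_doms //= phi orbF => /(_ isT isT isT) l1S.
    by rewrite Ec /= l1S in nS.
  - by rewrite !inE => /orP[] /eqP El; rewrite El in cS;
      [apply: (fire l1 l2) => //; left|apply: (fire l2 l1) => //; right].
  - have := congr1 size Ec; rewrite /bic_lits size_cat !size_map => Es.
    by rewrite Es /= in sz.
(* Here [r] itself violates the ground clause, so the triggering rule fires. *)
case/negP: nS; have := Hrule _ (rule_trigger bI r v ICc).
rewrite /= !has_map all_cat all_doms //= phi; apply=> //.
  apply/hasPn => a ac /=; rewrite answer_old.
  apply: contra nr => ar'; apply/hasP; exists (true, a).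
    by rewrite mem_cat map_f.
  by rewrite /lit_true ar'.
rewrite all_map; apply/allP => a ac /=; rewrite answer_old.
apply: contraNT nr => nar; apply/hasP; exists (false, a).
  by rewrite mem_cat orbC map_f.
by rewrite /lit_true /= eqbF_neg.
Qed.

Lemma nviolated_change_weak :
  nviolated (change_weak D ar) S = #|sym_diff r (inst_of S)|.
Proof.
(* As [S] and [r] have the same [old] atoms, [w a] is the only weak constraint on [a] that [S] can
   violate, and it is violated exactly when [a] changes. *)
pose w (a : gatom D ar) : wconstraint D ar :=
  if a \in r then ([set nnew a; old a], set0) else ([set new a], [set old a]).
have w_inj : injective w.
  move=> a b; rewrite /w; case: ifP => _; case: ifP => _ [E1].
  - by have := set21 (nnew a) (old a); rewrite E1 !inE /= => /orP[/eqP[]|].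
  - by have := set21 (nnew a) (old a); rewrite E1 !inE.
  - by have := set11 (new a); rewrite E1 !inE.
  - by move=> _; have := set11 (new a); rewrite E1 !inE => /eqP[].
case: (ansS) => ncS _ _.
rewrite /nviolated -(card_imset _ w_inj); apply: eq_card => x; apply/idP/idP.
  rewrite inE => /andP[/setUP[] /imsetP[a _ ->]]; rewrite /violated /=.
    rewrite sub1set disjoints1 answer_old => /andP[na anr].
    apply/imsetP; exists a; last by rewrite /w (negbTE anr).
    by rewrite in_setU !in_setD inst_ofE na anr.
  rewrite subUset !sub1set answer_old => /andP[/andP[na ar'] _].
  apply/imsetP; exists a; last by rewrite /w ar'.
  rewrite in_setU !in_setD inst_ofE na ar' andbF orbF /= orbF andbT.
  exact: (ncS (nnew a)).
case/imsetP=> a; rewrite in_setU !in_setD inst_ofE => asd ->.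
rewrite inE /w; case: ifPn asd => ar' /=.
  rewrite andbT orbF negb_or negbK => /andP[_ na].
  rewrite /violated /= subUset !sub1set na answer_old ar' /=.
  apply/andP; split; last by apply/pred0P => l; rewrite /= inE.
  by apply/setUP; right; apply/imsetP; exists a.
rewrite andbF /= orbF => na; rewrite /violated /= sub1set na disjoints1.
rewrite answer_old ar' !andbT.
by apply/setUP; left; apply/imsetP; exists a.
Qed.

End AnswerSets.

Lemma answer_set_below (r' : instance D ar) : sat_ics bI IC r' ->
  exists2 S, answer_set Pi S & sym_diff r (inst_of S) \subset sym_diff r r'.
Proof.
move=> sat'.
pose S0 : {set lit D ar} := [set l | match l.2 with
  | AOld a => l.1 && (a \in r)
  | ANew a => (a \in r') == l.1
  | ADom _ => l.1
  end].
have nc0 : no_compl S0.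
  by case=> b [] a; rewrite !inE /=; case: b => //=; case: (a \in r').
have old0 a : (old a \in S0) = (a \in r) by rewrite inE.
have prim0 k (v : 'I_k -> D) l : (primed v l \in S0) = lit_true r' v l.
  by rewrite inE.
have mod0 : holds_rules S0 (reduct S0 Pi).
  apply/holds_reductP => rl [a ar'|d|c v ICc|c v ch ot ICc Ec|c v l ICc Ec] /=.
  - by rewrite old0 ar'.
  - by rewrite inE.
  - move=> _ _ phi; have /sat_bicE/(_ v) := sat' _ ICc.
    rewrite (negbTE phi) orbF has_map; apply: sub_has => l /=.
    by rewrite prim0.
  - move=> _; rewrite all_cat /= => /and3P[_ chS _] phi.
    have /sat_bicE/(_ v) := sat' _ ICc.
    have /negbTE nch : ~~ lit_true r' v ch.
      by rewrite -prim0; apply/negP => /nc0; rewrite chS.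
    by rewrite (negbTE phi) prim0 !orbF; case: Ec => -> /=; rewrite nch ?orbF.
  - move=> _ _ phi; have /sat_bicE/(_ v) := sat' _ ICc.
    by rewrite (negbTE phi) Ec prim0 /= !orbF.
pose isModel (T : {set lit D ar}) := `[< holds_rules T (reduct S0 Pi) >].
(* Minimality is first obtained for the reduct by [S0]; [redE] below moves it to the reduct by [S],
   as both sets have the same [old] atoms. *)
have [|S /minsetP[/asboolP modS minS] sub0] := @minset_exists _ isModel S0.
  exact/asboolP.
have oldS a : (old a \in S) = (old a \in S0).
  apply/idP/idP => [/(subsetP sub0) //|].
  by rewrite old0; apply: model_old modS a.
have redE T : holds_rules T (reduct S Pi) <-> holds_rules T (reduct S0 Pi).
  split=> /holds_reductP H; apply/holds_reductP => rl Prl nS; apply: H => //.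
    by rewrite (eq_has_naf oldS).
  by rewrite -(eq_has_naf oldS).
exists S.
  split.
  - move=> l /(subsetP sub0) /nc0; apply: contra; exact: (subsetP sub0).
  - exact/redE.
  - by move=> T _ /redE modT subT; apply: minS => //; apply/asboolP.
(* Primed literals of [S] lie in [S0], hence are true in [r']: every change made by [S] leads
   towards [r']. *)
apply/subsetP => a; rewrite in_setU !in_setD !inE oldS old0.
have newr : new a \in S -> a \in r' by move/(subsetP sub0); rewrite inE /= eqb_id.
have nnewr : nnew a \in S -> a \notin r'.
  by move/(subsetP sub0); rewrite inE /= eqbF_neg.
case: (a \in r) => /=; rewrite ?andbT ?andbF ?orbF //=.
by rewrite negb_or negbK => /andP[_ /nnewr].
Qed.

End ChangeProgram.

Theorem theorem3 (D : finType) (P : finType) (ar : P -> nat)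
    (B : Type) (bar : B -> nat) (bI : forall b : B, pred ((bar b).-tuple D))
    (r : instance D ar) (IC : bic D ar bar -> Prop)
    (IC_consistent : consistent_ics bI IC) :
  (forall r' : instance D ar, dalal_repair bI IC r r' ->
     exists S : {set lit D ar},
       wanswer_set (dalal_program bI IC r) S /\ inst_of S = r') /\
  (forall S : {set lit D ar}, wanswer_set (dalal_program bI IC r) S ->
     exists r' : instance D ar,
       dalal_repair bI IC r r' /\ inst_of S = r').
Proof.
split=> [r' [sat' min']|S [ansS minS]]; last first.
  exists (inst_of S); split=> //; split; first exact: inst_of_sat ansS.
  (* Any competitor [rs] is matched by an answer set [T] with no more changes, and [S] violates no
     more weak constraints than [T]. *)
  move=> rs /answer_set_below - /(_ r)[T ansT /subset_leq_card].
  apply: leq_trans.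
  rewrite -(nviolated_change_weak ansS) -(nviolated_change_weak ansT).
  exact: minS.
have [S ansS sub] := answer_set_below r sat'.
have satS := inst_of_sat ansS.
(* One inclusion is [sub]; since [inst_of S] satisfies [IC], minimality of [r'] makes the
   cardinalities agree. *)
have Esd : sym_diff r (inst_of S) = sym_diff r r'.
  by apply/eqP; rewrite eqEcard sub min'.
exists S; split; last first.
  (* An instance is determined by its symmetric difference with [r]. *)
  move: (inst_of S) Esd => I /setP Esd; apply/setP => a; move: (Esd a).
  rewrite !in_setU !in_setD.
  by case: (a \in r); case: (a \in r'); case: (a \in I).
split=> // T ansT /=.
rewrite (nviolated_change_weak ansS) (nviolated_change_weak ansT) Esd.
exact: min' (inst_of_sat ansT).
Qed.
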